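(* Let $M\ge1$ be an integer, $0<S_0\le M$ and $0<c<1$. There exists an algorithm for $c$-approximate near neighbor search with respect to set intersection (binary inner product), for data and queries of sparsity bounded by $M$, that for a collection of $n\ge 2$ points requires $O(n^{1+\rho_{MH-ALSH}})$ space and $O(n^{\rho_{MH-ALSH}}\log n)$ query time, where $$\rho_{MH-ALSH}=\frac{\log\frac{S_0}{2M-S_0}}{\log\frac{cS_0}{2M-cS_0}}<1 .$$
   Context: The $c$-approximate near neighbor problem for the similarity $Sim(q,x)=q^Tx$ on binary vectors with at most $M$ nonzeros: given a collection $\mathcal{C}$ of $n$ vectors in $\{0,1\}^D$, each with at most $M$ nonzeros, and parameters $S_0>0$, $0<c<1$ and $0<\delta<1$, construct a (randomized) data structure which, given any query $q\in\{0,1\}^D$ with at most $M$ nonzeros, does the following with probability at least $1-\delta$: if there exists $x\in\mathcal{C}$ with $q^Tx\ge S_0$, it reports some $x'\in\mathcal{C}$ with $q^Tx'\ge cS_0$. Cost conventions (standard for locality sensitive hashing): evaluating one hash function on one point, computing one inner product, and storing one point, one pointer, or one hash function each cost $O(1)$; implied constants may depend on $c,S_0,M,\delta$ but not on $n$ or $D$. *)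

(* Defs.v *)
From HB Require Import structures.
From mathcomp Require Import all_boot all_order all_algebra.
From mathcomp Require Import all_classical all_reals all_analysis.

Set Implicit Arguments.
Unset Strict Implicit.
Unset Printing Implicit Defensive.

Import Order.TTheory GRing.Theory Num.Theory.
Local Open Scope ring_scope.

Definition point (D : nat) := {ffun 'I_D -> bool}.

Definition sim (D : nat) (q x : point D) : nat := (\sum_(i < D) q i * x i)%N.

Definition nnz (D : nat) (x : point D) : nat := (\sum_(i < D) x i)%N.

(* A finitely supported distribution on (asymmetric) hash functions for
   D-dimensional points: each function has one evaluation rule for data points
   and one for queries.  The distribution does not see the collection. *)
Record hash_family (R : realType) (D : nat) := HashFamily {
  hash_fun : finType;
  hash_prob : hash_fun -> R;
  hash_prob_ge0 : forall h, 0 <= hash_prob h;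
  hash_prob_sum1 : \sum_h hash_prob h = 1;
  hash_data : hash_fun -> point D -> nat;
  hash_query : hash_fun -> point D -> nat }.

(* The machine is a unit-cost random access machine.  A register or a memory
   cell holds a bounded integer (also used as a pointer), a point, or a hash
   function.  Points and hash functions are opaque: a program can only move
   them, evaluate a hash function on a point, or take an inner product. *)
Inductive value (R : realType) (D : nat) (F : hash_family R D) : Type :=
| Num of nat
| Pt of point D
| Hf of hash_fun F.
Arguments Num {R D F} _.
Arguments Pt {R D F} _.
Arguments Hf {R D F} _.

Inductive arith : Type := Add | Sub | Mul | Div.

Definition arith_fun (o : arith) : nat -> nat -> nat :=
  match o with Add => addn | Sub => subn | Mul => muln | Div => divn end.

(* Operands are register numbers, except for the literal k of Const. *)
Inductive instr : Type :=
| Const (r k : nat)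
| Copy (r a : nat)
| Arith (o : arith) (r a b : nat)
| Read (r a : nat)             (* r := memory cell number a *)
| Write (a r : nat)            (* memory cell number a := r *)
| HashData (r h p : nat)
| HashQuery (r h p : nat)
| Inner (r p p' : nat).

Inductive code : Type :=
| Do of instr
| Seq of code & code
| IfLt (a b : nat) (c1 c2 : code)
| WhileLt (a b : nat) (c : code).

Record state (R : realType) (D : nat) (F : hash_family R D) := State {
  regs : nat -> value F;
  mem : seq (value F) }.

Definition set_reg (R : realType) (D : nat) (F : hash_family R D)
    (s : state F) (r : nat) (v : value F) : state F :=
  State (fun k => if k == r then v else regs s k) (mem s).

Definition as_num (R : realType) (D : nat) (F : hash_family R D)
    (v : value F) : nat :=
  if v is Num k then k else 0%N.

(* Integers are reduced modulo W, so that every cell holds one machine word.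
   Operands of the wrong kind yield 0.  A write beyond the end of the memory
   extends it, so that size (mem s) is one more than the largest address
   written so far. *)
Definition exec_instr (R : realType) (D : nat) (F : hash_family R D)
    (W : nat) (i : instr) (s : state F) : state F :=
  let num k : value F := Num (k %% W)%N in
  match i with
  | Const r k => set_reg s r (num k)
  | Copy r a => set_reg s r (regs s a)
  | Arith o r a b =>
      set_reg s r (num (arith_fun o (as_num (regs s a)) (as_num (regs s b))))
  | Read r a => set_reg s r (nth (Num 0) (mem s) (as_num (regs s a)))
  | Write a r =>
      State (regs s) (set_nth (Num 0) (mem s) (as_num (regs s a)) (regs s r))
  | HashData r h p =>
      set_reg s r (match regs s h, regs s p with
                   | Hf f, Pt x => num (hash_data f x)
                   | _, _ => Num 0
                   end)
  | HashQuery r h p =>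
      set_reg s r (match regs s h, regs s p with
                   | Hf f, Pt x => num (hash_query f x)
                   | _, _ => Num 0
                   end)
  | Inner r p p' =>
      set_reg s r (match regs s p, regs s p' with
                   | Pt x, Pt y => num (sim x y)
                   | _, _ => Num 0
                   end)
  end.

Definition reg_lt (R : realType) (D : nat) (F : hash_family R D)
    (s : state F) (a b : nat) : bool :=
  (as_num (regs s a) < as_num (regs s b))%N.

(* runs W c s t s' : started in s, the code c halts in s' after t steps; every
   instruction and every test costs one step. *)
Inductive runs (R : realType) (D : nat) (F : hash_family R D) (W : nat) :
    code -> state F -> nat -> state F -> Prop :=
| runs_do i s : runs W (Do i) s 1 (exec_instr W i s)
| runs_seq c1 c2 s s1 s2 t1 t2 :
    runs W c1 s t1 s1 -> runs W c2 s1 t2 s2 ->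
    runs W (Seq c1 c2) s (t1 + t2)%N s2
| runs_if_true a b c1 c2 s s' t :
    reg_lt s a b -> runs W c1 s t s' -> runs W (IfLt a b c1 c2) s t.+1 s'
| runs_if_false a b c1 c2 s s' t :
    ~~ reg_lt s a b -> runs W c2 s t s' -> runs W (IfLt a b c1 c2) s t.+1 s'
| runs_while_stop a b c s :
    ~~ reg_lt s a b -> runs W (WhileLt a b c) s 1 s
| runs_while_step a b c s s1 s2 t1 t2 :
    reg_lt s a b -> runs W c s t1 s1 -> runs W (WhileLt a b c) s1 t2 s2 ->
    runs W (WhileLt a b c) s (t1 + t2).+1 s2.

Lemma runs_det (R : realType) (D : nat) (F : hash_family R D) (W : nat)
    (c : code) (s s1 s2 : state F) (t1 t2 : nat) :
  runs W c s t1 s1 -> runs W c s t2 s2 -> t1 = t2 /\ s1 = s2.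
Proof.
move=> H; elim: H t2 s2 => {c s t1 s1}
  [i s|c1 c2 s s1 s2 t1 t2 _ I1 _ I2|a b c1 c2 s s' t T _ I
  |a b c1 c2 s s' t T _ I|a b c s T|a b c s s1 s2 t1 t2 T _ I1 _ I2] u v H.
- by inversion H.
- inversion H as [|? ? ? s3 ? u1 u2 H1 H2| | | |]; subst.
  have [? ?] := I1 _ _ H1; subst.
  by have [-> ->] := I2 _ _ H2.
- inversion H as [| |? ? ? ? ? ? ? T' H'|? ? ? ? ? ? ? T' H'| |]; subst.
    by have [-> ->] := I _ _ H'.
  by rewrite T in T'.
- inversion H as [| |? ? ? ? ? ? ? T' H'|? ? ? ? ? ? ? T' H'| |]; subst.
    by rewrite T' in T.
  by have [-> ->] := I _ _ H'.
- inversion H as [| | | |? ? ? ? T'|? ? ? ? ? ? ? ? T' H1 H2]; subst=> //.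
  by rewrite T' in T.
- inversion H as [| | | |? ? ? ? T'|? ? ? ? s3 ? u1 u2 T' H1 H2]; subst.
    by rewrite T in T'.
  have [? ?] := I1 _ _ H1; subst.
  by have [-> ->] := I2 _ _ H2.
Qed.

(* One pair of programs serves all numbers of points, all dimensions and all
   collections.  The preprocessing receives alg_draws n independent draws from
   the hash family, which are the only source of randomness.  Words have
   O(log (n + D)) bits: integers are taken modulo (n + D + 2) ^ alg_word. *)
Record algorithm (R : realType) := Algorithm {
  alg_family : forall D : nat, hash_family R D;
  alg_draws : nat -> nat;
  alg_word : nat;
  alg_pre : code;
  alg_query : code }.

Definition word_bound (R : realType) (A : algorithm R) (n D : nat) : nat :=
  ((n + D).+2 ^ alg_word A)%N.

Definition draws (R : realType) (A : algorithm R) (n D : nat) :=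
  {ffun 'I_(alg_draws A n) -> hash_fun (alg_family A D)}.

Definition prob (R : realType) (A : algorithm R) (n D : nat)
    (E : draws A n D -> Prop) : R :=
  \sum_(w : draws A n D | `[< E w >]) \prod_j hash_prob (w j).

Definition init_regs (R : realType) (D : nat) (F : hash_family R D)
    (l : seq (value F)) : nat -> value F :=
  nth (Num 0) l.

(* Initially the memory consists of the n points followed by the drawn hash
   functions, and registers 0, 1, 2 contain n, the number of draws, and D. *)
Definition pre_state (R : realType) (A : algorithm R) (n D : nat)
    (x : 'I_n -> point D) (w : draws A n D) : state (alg_family A D) :=
  let num k := Num (k %% word_bound A n D)%N in
  State (init_regs [:: num n; num (alg_draws A n); num D])
        ([seq Pt (x i) | i <- enum 'I_n] ++
         [seq Hf (w j) | j <- enum 'I_(alg_draws A n)]).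

(* The query program starts from the memory left by the preprocessing, with
   q, n, the number of draws and D in registers 0, 1, 2, 3. *)
Definition query_state (R : realType) (A : algorithm R) (n D : nat)
    (m : seq (value (alg_family A D))) (q : point D) :
    state (alg_family A D) :=
  let num k := Num (k %% word_bound A n D)%N in
  State (init_regs [:: Pt q; num n; num (alg_draws A n); num D]) m.

Definition pre_run (R : realType) (A : algorithm R) (n D : nat)
    (x : 'I_n -> point D) (w : draws A n D)
    (t : nat) (s : state (alg_family A D)) : Prop :=
  runs (word_bound A n D) (alg_pre A) (pre_state x w) t s.

(* t counts the steps of the query program only. *)
Definition query_run (R : realType) (A : algorithm R) (n D : nat)
    (x : 'I_n -> point D) (w : draws A n D) (q : point D)
    (t : nat) (s : state (alg_family A D)) : Prop :=
  exists t0 s0, pre_run x w t0 s0 /\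
    runs (word_bound A n D) (alg_query A) (query_state n (mem s0) q) t s.

Definition sparse_data (M n D : nat) (x : 'I_n -> point D) : Prop :=
  forall i, (nnz (x i) <= M)%N.

(* The value in register 0 at the end of the query program is the report. *)
Definition solves_near_neighbor (R : realType) (A : algorithm R)
    (M : nat) (S0 c delta : R) : Prop :=
  forall (n D : nat) (x : 'I_n -> point D) (q : point D),
    (2 <= n)%N -> sparse_data M x -> (nnz q <= M)%N ->
    1 - delta <= prob (fun w : draws A n D =>
      (exists i, S0 <= (sim q (x i))%:R) ->
      exists t s i, [/\ query_run x w q t s, regs s 0%N = Pt (x i)
                      & c * S0 <= (sim q (x i))%:R]).

(* O(f n) memory cells, the input and the scratch memory of the query program
   included, for all outcomes of the draws; the constant is uniform in D. *)
Definition space_bigO (R : realType) (A : algorithm R) (M : nat)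
    (f : nat -> R) : Prop :=
  exists K : R, forall (n D : nat) (x : 'I_n -> point D) (w : draws A n D),
    (2 <= n)%N -> sparse_data M x ->
    (exists t s, pre_run x w t s /\ (size (mem s))%:R <= K * f n) /\
    (forall q : point D, (nnz q <= M)%N ->
       exists t s, query_run x w q t s /\ (size (mem s))%:R <= K * f n).

Definition query_time_bigO (R : realType) (A : algorithm R) (M : nat)
    (f : nat -> R) : Prop :=
  exists K : R, forall (n D : nat) (x : 'I_n -> point D) (w : draws A n D)
      (q : point D),
    (2 <= n)%N -> sparse_data M x -> (nnz q <= M)%N ->
    exists t s, query_run x w q t s /\ t%:R <= K * f n.

Definition rho_MH_ALSH (R : realType) (M : nat) (S0 c : R) : R :=
  ln (S0 / (2 * M%:R - S0)) / ln (c * S0 / (2 * M%:R - c * S0)).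

(* Main.v *)
Require Import Defs.
From HB Require Import structures.
From mathcomp Require Import all_boot all_order all_algebra.
From mathcomp Require Import all_classical all_reals all_analysis.
From mathcomp Require Import zify lra.
Import Order.TTheory GRing.Theory Num.Theory.
(* mathcomp-analysis shadows the name [code]. *)
Import Defs.

Set Implicit Arguments.
Unset Strict Implicit.
Unset Printing Implicit Defensive.

(* Since constants may depend on M, a deterministic dictionary beats the
   exponent rho.  Let s be the least integer at least S0.  Two points have inner
   product at least s iff some s-tuple of distinct coordinates lies in both
   supports, and a point with at most M nonzeros has at most M ^ s such tuples,
   its keys.  The preprocessing lists the keys of all data points in increasing
   order, each with the index of its point; the query looks up each of its own
   keys by binary search and tests the point found by an inner product.  This
   takes O(n) space and O(log n) time, and rho >= 0 because both logarithms in
   its definition are nonpositive.  The only hash function maps a point to its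
   list of keys, packed into one integer. *)

Local Notation "c1 ;; c2" := (Seq c1 c2) (at level 61, right associativity).

Local Notation num s r := (as_num (regs s r)).

(** * Time-bounded weakest preconditions *)

Section WeakestPrecondition.
Variables (R : realType) (D : nat) (F : hash_family R D) (W : nat).
Implicit Types (c : code) (s : state F) (t : nat) (Q : state F -> Prop).

(** Total correctness with [t] only an upper bound on the steps, so that branches of different
    lengths can share it. *)
Definition wp c s t Q := exists t' s', [/\ runs W c s t' s', (t' <= t)%N & Q s'].

Lemma wp_impl c s t Q Q' : (forall s', Q s' -> Q' s') -> wp c s t Q -> wp c s t Q'.
Proof. by move=> QQ' [t' [s' [? ? ?]]]; exists t', s'; split=> //; exact: QQ'. Qed.

Lemma wp_weaken c s t t' Q : (t <= t')%N -> wp c s t Q -> wp c s t' Q.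
Proof.
by move=> le_t [u [s' [? le_u ?]]]; exists u, s'; split=> //; exact: leq_trans le_t.
Qed.

Lemma wp_seq c1 c2 s t t1 t2 Q :
  (t1 + t2 <= t)%N -> wp c1 s t1 (fun s1 => wp c2 s1 t2 Q) ->
  wp (c1 ;; c2) s t Q.
Proof.
move=> le_t [u1 [s1 [run1 le1 [u2 [s2 [run2 le2 Qs2]]]]]].
exists (u1 + u2)%N, s2; split=> //; first exact: runs_seq run1 run2.
by apply: leq_trans le_t; exact: leq_add.
Qed.

Lemma wp_do i s t Q : Q (exec_instr W i s) -> wp (Do i) s t.+1 Q.
Proof. by exists 1, (exec_instr W i s); split=> //; exact: runs_do. Qed.

Lemma wp_seq_do i c s t Q :
  wp (Do i) s 1 (fun s' => wp c s' t Q) -> wp (Do i ;; c) s t.+1 Q.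
Proof. by apply: wp_seq; rewrite add1n. Qed.

Lemma wp_const r k s t Q :
  (k < W)%N -> Q (set_reg s r (Num k)) -> wp (Do (Const r k)) s t.+1 Q.
Proof. by move=> ltkW Qs; apply: wp_do; rewrite /= modn_small. Qed.

Lemma wp_arith o r a b v s t Q :
  arith_fun o (num s a) (num s b) = v -> (v < W)%N ->
  Q (set_reg s r (Num v)) -> wp (Do (Arith o r a b)) s t.+1 Q.
Proof. by move=> <- ltvW Qs; apply: wp_do; rewrite /= modn_small. Qed.

Lemma wp_if a b c1 c2 s t Q :
  (reg_lt s a b -> wp c1 s t Q) -> (~~ reg_lt s a b -> wp c2 s t Q) ->
  wp (IfLt a b c1 c2) s t.+1 Q.
Proof.
case: (boolP (reg_lt s a b)) => [lt_ab /(_ isT) + _|ge_ab _ /(_ isT)].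
  move=> [t' [s' [? ? ?]]]; exists t'.+1, s'.
  by split=> //; apply: runs_if_true.
move=> [t' [s' [? ? ?]]]; exists t'.+1, s'.
by split=> //; apply: runs_if_false.
Qed.

(** The index of [I] is fuel, decreasing by one per round. A round costs its test and its body, and
    one failing test ends the loop, possibly with fuel left. *)
Lemma wp_while (I : nat -> state F -> Prop) a b c tb m s :
  (forall m s, I m s -> reg_lt s a b ->
     exists2 m', m = m'.+1 & wp c s tb (I m')) ->
  I m s ->
  wp (WhileLt a b c) s (m * tb.+1).+1
     (fun s' => ~~ reg_lt s' a b /\ exists m', I m' s').
Proof.
move=> body; elim: m s => [|m IHm] s Is.
  have [/(body _ _ Is)[] //|ge_ab] := boolP (reg_lt s a b).
  by exists 1, s; split; [exact: runs_while_stop | | split=> //; exists 0].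
have [lt_ab|ge_ab] := boolP (reg_lt s a b); last first.
  by exists 1, s; split; [exact: runs_while_stop | | split=> //; exists m.+1].
have [_ [<-] [t1 [s1 [run1 le1 Is1]]]] := body _ _ Is lt_ab.
have [t2 [s2 [run2 le2 Is2]]] := IHm _ Is1.
exists (t1 + t2).+1, s2; split=> //; first exact: runs_while_step run1 run2.
by lia.
Qed.

(** Frame condition: [X] lists the registers that a program may have changed. *)
Definition agree (X : seq nat) s s' :=
  forall k, k \notin X -> regs s' k = regs s k.

Lemma agree_set X r v s s' :
  r \in X -> agree X s s' -> agree X s (set_reg s' r v).
Proof.
by move=> rX ss' k kX /=; case: eqP kX => [->|_ kX]; rewrite ?rX //; exact: ss'.
Qed.

Lemma agree_trans X Y s s' s'' :
  subseq Y X -> agree X s s' -> agree Y s' s'' -> agree X s s''.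
Proof.
move=> /mem_subseq YX ss' ss'' k kX; rewrite ss''; first exact: ss'.
by apply: contra kX; exact: YX.
Qed.

(** * Subroutines: remainder, powers, digit shift, binary search *)

Definition modulo r a b :=
  Do (Arith Div r a b) ;; Do (Arith Mul r r b) ;; Do (Arith Sub r a r).

Lemma set_set_reg s r v v' : set_reg (set_reg s r v) r v' = set_reg s r v'.
Proof. by congr State; apply: funext => k /=; case: eqP. Qed.

(** The remainder is computed as [a - (a / b) * b]. Register [r] holds the intermediate values, so
    it must differ from [a] and [b]; these values are at most [a], so none overflows. *)
Lemma wp_modulo r a b v s t Q :
  r != a -> r != b -> num s a %% num s b = v -> (num s a < W)%N ->
  Q (set_reg s r (Num v)) -> wp (modulo r a b) s t.+3 Q.
Proof.
rewrite /modulo ![r == _]eq_sym => /negPf ra /negPf rb <- ltaW Qs.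
apply: wp_seq_do; apply: wp_arith => //.
  exact: leq_ltn_trans (leq_div _ _) ltaW.
apply: wp_seq_do; apply: (wp_arith (v := num s a %/ num s b * num s b)).
- by rewrite /= eqxx rb.
- exact: leq_ltn_trans (leq_divM _ _) ltaW.
rewrite set_set_reg; apply: (wp_arith (v := num s a %% num s b)).
- by rewrite /= eqxx ra {1}(divn_eq (num s a) (num s b)) addKn.
- exact: leq_ltn_trans (leq_mod _ _) ltaW.
by rewrite set_set_reg.
Qed.

Definition power_loop :=
  WhileLt 7 8 (Do (Arith Mul 6 6 5) ;; Do (Arith Add 7 7 4)).

Lemma wp_power_loop d e s :
  num s 4 = 1 -> num s 5 = d -> num s 6 = 1 -> num s 7 = 0 -> num s 8 = e ->
  (0 < d)%N -> (d ^ e < W)%N -> (e < W)%N ->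
  wp power_loop s (e * 3).+1
     (fun s' => [/\ num s' 6 = d ^ e, mem s' = mem s & agree [:: 6; 7] s s']).
Proof.
move=> s4 s5 s6 s7 s8 d_gt0 ltdW lteW.
pose I m s' := [/\ num s' 7 + m = e, num s' 6 = d ^ num s' 7, mem s' = mem s
                 & agree [:: 6; 7] s s'].
have I0 : I e s by split; rewrite ?s6 ?s7.
apply: wp_impl (wp_while _ I0) => [s' [ge [m [s7m s6' ms ag]]]|].
  split=> //; rewrite s6'; congr (_ ^ _).
  by move: ge; rewrite /reg_lt (ag 8 isT) s8; lia.
move=> m s1 [s7m s6' ms ag]; have S := (ag 4 isT, ag 5 isT, ag 8 isT).
rewrite /reg_lt !S s8 => lt7; exists m.-1; first by lia.
apply: wp_seq_do; apply: (wp_arith (v := d ^ (num s1 7).+1)).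
- by rewrite /= S s5 s6' expnSr.
- by apply: leq_ltn_trans ltdW; rewrite leq_pexp2l.
apply: (wp_arith (v := (num s1 7).+1)); first by rewrite /= S s4 addn1.
  by lia.
split=> //=; first by lia.
by do 2!apply: agree_set => //.
Qed.

Definition powers d e :=
  Do (Const 4 1) ;; Do (Arith Add 5 d 4) ;; Do (Const 6 1) ;; Do (Const 7 0) ;;
  Do (Const 8 e) ;; power_loop.

Lemma wp_powers r e d s :
  r \notin [:: 4; 5; 6; 7; 8] -> num s r = d ->
  (1 < W)%N -> (d.+1 < W)%N -> (d.+1 ^ e < W)%N -> (e < W)%N ->
  wp (powers r e) s (e * 3 + 6)
     (fun s' => [/\ num s' 4 = 1, num s' 6 = d.+1 ^ e, mem s' = mem s
                  & agree [:: 4; 5; 6; 7; 8] s s']).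
Proof.
rewrite !addnS addn0 !inE !negb_or => /andP[/negPf r4 _] sr lt1W ltdW ltbW lteW.
apply: wp_seq_do; apply: wp_const => //.
apply: wp_seq_do; apply: (wp_arith (v := d.+1)) => //.
  by rewrite /= r4 sr addn1.
do 3!(apply: wp_seq_do; apply: wp_const; first by lia).
apply: wp_impl (wp_power_loop (e := e) (d := d.+1) _ _ _ _ _ _ _ _) => //.
move=> s' [s6 ms ag]; split=> //; first by rewrite (ag 4 isT).
apply: (agree_trans (Y := [:: 6; 7])) ag => //.
by do !apply: agree_set => //.
Qed.

Definition div_loop :=
  WhileLt 7 17 (Do (Arith Div 19 19 6) ;; Do (Arith Add 7 7 4)).

(** In base [b], this shifts out the lowest [j] digits of register 19. *)
Lemma wp_div_loop b j v s :
  num s 4 = 1 -> num s 6 = b -> num s 7 = 0 -> num s 17 = j -> num s 19 = v ->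
  (v < W)%N -> (j < W)%N ->
  wp div_loop s (j * 3).+1
     (fun s' => [/\ num s' 19 = v %/ b ^ j, mem s' = mem s
                  & agree [:: 7; 19] s s']).
Proof.
move=> s4 s6 s7 s17 s19 ltvW ltjW.
pose I m s' := [/\ num s' 7 + m = j, num s' 19 = v %/ b ^ num s' 7,
                   mem s' = mem s & agree [:: 7; 19] s s'].
have I0 : I j s by split; rewrite ?s19 ?s7 ?divn1.
apply: wp_impl (wp_while _ I0) => [s' [ge [m [s7m s19' ms ag]]]|].
  split=> //; rewrite s19'; congr (_ %/ _ ^ _).
  by move: ge; rewrite /reg_lt (ag 17 isT) s17; lia.
move=> m s1 [s7m s19' ms ag]; have S := (ag 4 isT, ag 6 isT, ag 17 isT).
rewrite /reg_lt !S s17 => lt7; exists m.-1; first by lia.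
apply: wp_seq_do; apply: (wp_arith (v := v %/ b ^ (num s1 7).+1)).
- by rewrite /= S s6 s19' expnSr divnMA.
- exact: leq_ltn_trans (leq_div _ _) ltvW.
apply: (wp_arith (v := (num s1 7).+1)); first by rewrite /= S s4 addn1.
  by lia.
split=> //=; first by lia.
by do 2!apply: agree_set => //.
Qed.

Definition search_loop :=
  WhileLt 12 13
    (Do (Arith Add 16 12 13) ;; Do (Const 17 2) ;; Do (Arith Div 16 16 17) ;;
     Do (Arith Add 18 11 16) ;; Do (Read 18 18) ;;
     IfLt 18 15 (Do (Arith Add 12 16 4)) (Do (Copy 13 16))).

(** Entries before register 12 are below [x], those from register 13 on are not. The gap, less than
    [2 ^ m] with fuel [m], is halved in each round of eight steps. *)
Lemma wp_search (a : seq nat) o x l s :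
  sorted leq a -> (size a < 2 ^ l)%N ->
  (2 < W)%N -> (o + size a < W)%N -> (size a + size a < W)%N ->
  (forall p, (p < size a)%N -> nth (Num 0) (mem s) (o + p) = Num (nth 0 a p)) ->
  num s 4 = 1 -> num s 11 = o -> num s 12 = 0 -> num s 13 = size a ->
  num s 15 = x ->
  wp search_loop s (l * 8).+1
     (fun s' => [/\ mem s' = mem s, agree [:: 12; 13; 16; 17; 18] s s' &
        [/\ (num s' 12 <= size a)%N,
        forall p, (p < num s' 12)%N -> (nth 0 a p < x)%N &
        forall p, (num s' 12 <= p < size a)%N -> (x <= nth 0 a p)%N]]).
Proof.
move=> a_sorted lt_al lt2W ltoW ltaW mem_a s4 s11 s12 s13 s15.
have le_a p p' : (p <= p')%N -> (p' < size a)%N -> (nth 0 a p <= nth 0 a p')%N.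
  move=> lepp' ltp'; apply: (sorted_leq_nth leq_trans leqnn) => //.
  by rewrite inE; exact: leq_ltn_trans ltp'.
pose I m s' := [/\ mem s' = mem s, agree [:: 12; 13; 16; 17; 18] s s',
   (num s' 12 <= num s' 13 <= size a)%N,
   (num s' 13 - num s' 12 < 2 ^ m)%N &
   (forall p, (p < num s' 12)%N -> (nth 0 a p < x)%N) /\
   (forall p, (num s' 13 <= p < size a)%N -> (x <= nth 0 a p)%N)].
have I0 : I l s.
  split; rewrite ?s12 ?s13 ?leq0n ?subn0 ?leqnn //.
  by split=> // p /andP[/leq_ltn_trans h /h]; rewrite ltnn.
apply: wp_impl (wp_while _ I0) => [s' [ge [m [ms ag le13 _ [lo hi]]]]|].
  have e1213 : num s' 12 = num s' 13 by move: ge; rewrite /reg_lt; lia.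
  split=> //; split=> //; first by lia.
  by move=> p; rewrite e1213; exact: hi.
move=> m s1 [ms ag le13 lt_m [lo hi]].
have S := (ag 4 isT, ag 11 isT, ag 15 isT).
(* Without fuel the gap is below [2 ^ 0], hence empty, against the loop test. *)
rewrite /reg_lt => lt12; case: m lt_m => [|m lt_m]; first by lia.
exists m => //.
pose mid := (num s1 12 + num s1 13) %/ 2.
have mid_ge : (num s1 12 <= mid)%N by rewrite /mid; lia.
have mid_lt : (mid < num s1 13)%N by rewrite /mid; lia.
have lt_mid : (mid < size a)%N by lia.
apply: wp_seq_do; apply: (wp_arith (v := num s1 12 + num s1 13)) => //.
  by lia.
apply: wp_seq_do; apply: wp_const => //.
apply: wp_seq_do; apply: (wp_arith (v := mid)) => //.
  by lia.
apply: wp_seq_do; apply: (wp_arith (v := o + mid)).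
- by rewrite /= S s11.
- by lia.
apply: wp_seq_do; apply: wp_do => /=; rewrite ms mem_a //.
apply: wp_if => [|]; rewrite /reg_lt /= S s15 => ltx.
  apply: (wp_arith (v := mid.+1)); rewrite /= ?S ?s4 ?addn1 //.
    by lia.
  split=> //=; first by do !apply: agree_set => //.
  - by lia.
  - by move: lt_m; rewrite expnS /mid; lia.
  - split=> // p ltp; apply: leq_ltn_trans ltx; exact: le_a.
apply: wp_do; split=> //=; first by do !apply: agree_set => //.
- by lia.
- by move: lt_m; rewrite expnS /mid; lia.
- split=> // p /andP[lep ltp]; apply: leq_trans (le_a _ _ lep ltp).
  by rewrite leqNgt.
Qed.

End WeakestPrecondition.

(** * Keys and the sorted table *)

(** Least significant digit first, so that the list is consumed from its head by dividing by [b]. *)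
Definition digits_val (b : nat) (l : seq nat) : nat :=
  foldr (fun d v => d + b * v) 0 l.

Lemma digits_val_drop b l j :
  all (fun d => d < b) l -> digits_val b l %/ b ^ j = digits_val b (drop j l).
Proof.
elim: l j => [|d l IHl] [|j] //=; rewrite ?div0n ?divn1 // => /andP[ltdb ltlb].
have b_gt0 : 0 < b by exact: leq_ltn_trans ltdb.
by rewrite expnS divnMA addnC mulnC divnMDl // (divn_small ltdb) addn0 IHl.
Qed.

Lemma digits_val_mod b l :
  all (fun d => d < b) l -> digits_val b l %% b = head 0 l.
Proof.
case: l => [|d l] /=; first by rewrite mod0n.
by case/andP=> ltdb _; rewrite addnC mulnC modnMDl modn_small.
Qed.

Lemma digits_val_lt b l :
  all (fun d => d < b) l -> digits_val b l < b ^ size l.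
Proof.
elim: l => [|d l IHl] //= /andP[ltdb /IHl]; rewrite expnS -(leq_pmul2l (m := b)).
  by rewrite mulnS; apply: leq_trans; rewrite ltn_add2r.
exact: leq_ltn_trans ltdb.
Qed.

Lemma nnz_card D (x : point D) : nnz x = #|[set i | x i]|.
Proof.
by rewrite /nnz -sum1_card [RHS]big_mkcond; apply: eq_bigr => i _; rewrite inE; case: (x i).
Qed.

Lemma sim_card D (q x : point D) : sim q x = #|[set i | q i & x i]|.
Proof.
rewrite /sim -sum1_card [RHS]big_mkcond; apply: eq_bigr => i _.
by rewrite inE; case: (q i); case: (x i).
Qed.

Lemma sim_le D (q x : point D) : sim q x <= D.
Proof. by rewrite sim_card; apply: leq_trans (max_card _) _; rewrite card_ord. Qed.

(* Ranks are shifted by one so that no key equals 0, the value read off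
   beyond the last key. *)
Definition keys (s D : nat) (x : point D) : seq nat :=
  [seq (enum_rank t).+1 |
     t <- enum [set t : {ffun 'I_s -> 'I_D} | injectiveb t & [forall a, x (t a)]]].

(** Each tuple is a map from ['I_s] into the support of [x]. *)
Lemma size_keys s D (x : point D) : size (keys s x) <= nnz x ^ s.
Proof.
rewrite size_map -cardE nnz_card -[s in _ ^ s]card_ord -card_ffun_on.
apply/subset_leq_card/fintype.subsetP => t; rewrite inE => /andP[_ /forallP xt].
by apply/ffun_onP => a; rewrite inE.
Qed.

(** Shifted ranks reach at most [D ^ s], which is below [D.+1 ^ s] as [s > 0]. *)
Lemma keys_lt s D (x : point D) :
  0 < s -> all (fun k => k < D.+1 ^ s) (keys s x).
Proof.
move=> s_gt0; apply/allP => _ /mapP[t _ ->].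
have := ltn_ord (enum_rank t); rewrite [X in _ < X]card_ffun !card_ord.
by move=> /leq_ltn_trans; apply; rewrite ltn_exp2r.
Qed.

Lemma keys_gt0 s D (x : point D) k : k \in keys s x -> 0 < k.
Proof. by case/mapP=> t _ ->. Qed.

Lemma common_key s D (q x : point D) :
  reflect (exists2 k, k \in keys s q & k \in keys s x) (s <= sim q x).
Proof.
rewrite sim_card; apply: (iffP idP) => [le_s|[k]].
  (* The first [s] coordinates of the common support. *)
  pose t := [ffun a : 'I_s => enum_val (widen_ord le_s a)].
  have tqx a : q (t a) && x (t a).
    by have := enum_valP (widen_ord le_s a); rewrite inE ffunE.
  have t_inj : injectiveb t.
    apply/injectiveP => a a'; rewrite !ffunE => /enum_val_inj/(congr1 val)/= ?.
    exact: val_inj.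
  by exists (enum_rank t).+1; apply/map_f; rewrite mem_enum inE t_inj;
     apply/forallP => a; case/andP: (tqx a).
case/mapP => t; rewrite mem_enum inE => /andP[/injectiveP t_inj /forallP qt] ->.
case/mapP => t'; rewrite mem_enum inE => /andP[_ /forallP xt].
(* Equal keys come from the same tuple, whose image is a set of [s] common coordinates. *)
case=> /val_inj/enum_rank_inj eq_t; rewrite -eq_t in xt.
rewrite -[s in s <= _]card_ord -(card_codom t_inj).
apply/subset_leq_card/fintype.subsetP => _ /codomP[a ->].
by rewrite inE qt xt.
Qed.

(* Entry [T = k * N + r] records that slot [r] carries the key [k]. *)
Definition dict (key : nat -> nat) (b N : nat) : seq nat :=
  [seq T <- iota 0 (b * N) | key (T %% N) == T %/ N].

Lemma dict_sorted key b N : sorted leq (dict key b N).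
Proof. exact: (sorted_filter leq_trans _ (iota_sorted _ _)). Qed.

Lemma mem_dict key b N T : 0 < N -> (forall r, r < N -> key r < b) ->
  (T \in dict key b N) = (key (T %% N) == T %/ N).
Proof.
move=> N_gt0 key_lt; rewrite mem_filter mem_iota /= add0n.
case: eqP => //= eqT; rewrite -ltn_divLR // -eqT; apply: key_lt.
by rewrite ltn_mod.
Qed.

(** Each slot carries exactly one key, possibly the filler 0, so [r |-> key r * N + r] enumerates
    the entries without repetition. *)
Lemma size_dict key b N : 0 < N -> (forall r, r < N -> key r < b) ->
  size (dict key b N) = N.
Proof.
move=> N_gt0 key_lt; rewrite -[RHS](size_iota 0).
rewrite -(size_map (fun r => key r * N + r) (iota 0 N)); apply: perm_size.
have entryK r : r < N -> (key r * N + r) %% N = r /\ (key r * N + r) %/ N = key r.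
  by move=> ltrN; rewrite modnMDl modn_small // divnMDl // divn_small // addn0.
apply: uniq_perm.
- by rewrite filter_uniq // iota_uniq.
- rewrite map_inj_in_uniq ?iota_uniq // => r r'; rewrite !mem_iota /= !add0n.
  by move=> /entryK[rK _] /entryK[rK' _] eq_e; rewrite -[LHS]rK -[RHS]rK' eq_e.
move=> T; rewrite mem_dict //; apply/eqP/mapP => [eqT|[r]].
  exists (T %% N); first by rewrite mem_iota /= add0n ltn_mod.
  by rewrite eqT -divn_eq.
by rewrite mem_iota /= add0n => /entryK[rK kK] ->; rewrite rK kK.
Qed.

(** * The two programs *)

Section DictionaryPrograms.
Variables s B : nat.

(* Registers of both programs: 4 holds 1, 6 the base (D + 1) ^ s of the keys,
   9 the number B of keys per point, 10 the number n * B of slots.  While the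
   table is filled, 11 bounds the current entry in 12, and 13 is its address.
   While a query is answered, 11 is the address of the table, 12 and 13 are the
   ends of the searched interval, 15 is the smallest entry carrying the current
   key, 19 encodes the keys still to be tried, and 24 counts the tried ones. *)
Definition insert :=
  Do (Arith Div 14 12 10) ;; modulo 15 12 10 ;; Do (Arith Div 16 15 9) ;;
  modulo 17 15 9 ;; Do (Read 18 16) ;; Do (HashData 19 3 18) ;;
  Do (Const 7 0) ;; div_loop ;; modulo 20 19 6 ;;
  IfLt 20 14 (Do (Const 7 0))
    (IfLt 14 20 (Do (Const 7 0))
       (Do (Write 13 12) ;; Do (Arith Add 13 13 4))) ;;
  Do (Arith Add 12 12 4).

Definition insert_scratch := [:: 7; 12; 13; 14; 15; 16; 17; 18; 19; 20].

(** All candidates below [b * N], where [b] is the key base in register 6 and [N] the number of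
    slots, are tested in increasing order. The table is thus sorted as it is written, and no extra
    memory is taken. *)
Definition preprocess :=
  powers 2 s ;; Do (Read 3 0) ;; Do (Const 9 B) ;; Do (Arith Mul 10 0 9) ;;
  Do (Arith Mul 11 6 10) ;; Do (Const 12 0) ;; Do (Arith Add 13 0 4) ;;
  WhileLt 12 11 insert.

(** Entry [T] belongs to point [T / B mod n]. Register 0 is overwritten only after a successful
    inner product test, so a wrong candidate does no harm. *)
Definition lookup :=
  modulo 15 19 6 ;; Do (Arith Div 19 19 6) ;; Do (Arith Mul 15 15 10) ;;
  Do (Const 12 0) ;; Do (Copy 13 10) ;; search_loop ;; Do (Arith Add 18 11 12) ;;
  Do (Read 18 18) ;; Do (Arith Div 18 18 9) ;; modulo 16 18 1 ;;
  Do (Read 16 16) ;; Do (Inner 17 21 16) ;;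
  IfLt 17 23 (Do (Const 17 0)) (Do (Copy 0 16)) ;; Do (Arith Add 24 24 4).

Definition lookup_scratch := [:: 0; 12; 13; 15; 16; 17; 18; 19; 24].

Definition answer :=
  Do (Copy 21 0) ;; powers 3 s ;; Do (Read 22 1) ;; Do (Const 9 B) ;;
  Do (Arith Mul 10 1 9) ;; Do (Arith Add 11 1 4) ;; Do (HashQuery 19 22 21) ;;
  Do (Const 23 s) ;; Do (Const 24 0) ;; WhileLt 24 9 lookup.

(** Truncation gives every point the same number [B] of slots. Nothing is lost for points of
    sparsity [M] once [B = M ^ s]. *)
Definition key_list D (x : point D) := take B (keys s x).

Definition key_code D (x : point D) := digits_val (D.+1 ^ s) (key_list x).

Lemma sum_unit1 (R : realType) : (\sum_(h : unit) 1 = 1 :> R)%R.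
Proof. by rewrite sumr_const card_unit. Qed.

Definition key_family (R : realType) (D : nat) : hash_family R D :=
  HashFamily (fun=> ler01) (sum_unit1 R) (fun=> @key_code D) (fun=> @key_code D).

Section Runs.
Variables (R : realType) (D W : nat) (pts : seq (point D)).
Let F := key_family R D.
Let n := size pts.
Let N := n * B.
Let b := D.+1 ^ s.
Let p0 : point D := [ffun=> false].

(* Slot r = i * B + j holds the j-th key of the i-th point. *)
Definition slot_key r := nth 0 (key_list (nth p0 pts (r %/ B))) (r %% B).

Definition slots := dict slot_key b N.

Definition data_mem (h : hash_fun F) : seq (value F) :=
  rcons [seq Pt x | x <- pts] (Hf h).

Definition table_mem (h : hash_fun F) : seq (value F) :=
  data_mem h ++ [seq Num T | T <- slots].

Hypotheses (s_gt0 : 0 < s) (B_gt0 : 0 < B) (n_gt0 : 0 < n).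
(** All values computed by the programs stay below [W], so reduction modulo [W] never shows. *)
Hypotheses (sW : s < W) (BW : B < W) (DW : D.+1 < W).
Hypotheses (codeW : b ^ B <= W) (tableW : n.+1 + (b * N + N) < W).

Let N_gt0 : 0 < N. Proof. by rewrite muln_gt0 n_gt0. Qed.
Let b_gt0 : 0 < b. Proof. by rewrite expn_gt0. Qed.
Let le_bN : b <= b * N. Proof. by rewrite leq_pmulr. Qed.
Let le_NbN : N <= b * N. Proof. by rewrite leq_pmull. Qed.

Lemma key_list_lt (x : point D) : all (fun k => k < b) (key_list x).
Proof.
by apply/allP => k /mem_take; exact: (allP (keys_lt x s_gt0)).
Qed.

Lemma size_key_list (x : point D) : size (key_list x) <= B.
Proof. by rewrite size_take_min geq_minl. Qed.

Lemma slot_key_lt r : slot_key r < b.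
Proof.
rewrite /slot_key; set l := key_list _; have [lt_l|ge_l] := ltnP (r %% B) (size l).
  exact: (allP (key_list_lt _)) (mem_nth _ lt_l).
by rewrite nth_default.
Qed.

Lemma size_slots : size slots = N.
Proof. by apply: size_dict => // r _; exact: slot_key_lt. Qed.

Lemma mem_slots T : (T \in slots) = (slot_key (T %% N) == T %/ N).
Proof. by apply: mem_dict => // r _; exact: slot_key_lt. Qed.

Lemma key_codeW (x : point D) : key_code x < W.
Proof.
apply: leq_trans codeW; apply: leq_trans (digits_val_lt (key_list_lt x)) _.
by rewrite leq_pexp2l // size_key_list.
Qed.

Lemma key_code_digit (x : point D) j :
  key_code x %/ b ^ j %% b = nth 0 (key_list x) j.
Proof.
rewrite digits_val_drop ?key_list_lt // digits_val_mod; first by rewrite -nth0 nth_drop addn0.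
by apply/allP => k /mem_drop; exact: (allP (key_list_lt x)).
Qed.

Lemma nth_data_mem h i : i < n -> nth (Num 0) (data_mem h) i = Pt (nth p0 pts i).
Proof. by move=> ltin; rewrite nth_rcons size_map ltin (nth_map p0). Qed.

Lemma size_data_mem h : size (data_mem h) = n.+1.
Proof. by rewrite size_rcons size_map. Qed.

Lemma nth_data_hash h : nth (Num 0) (data_mem h) n = Hf h.
Proof. by rewrite nth_rcons size_map ltnn eqxx. Qed.

(** * Filling the table *)

Definition partial_table T : seq nat :=
  [seq T' <- iota 0 T | slot_key (T' %% N) == T' %/ N].

Lemma partial_tableS T :
  partial_table T.+1 =
  if slot_key (T %% N) == T %/ N then rcons (partial_table T) T
  else partial_table T.
Proof.
by rewrite /partial_table -addn1 iotaD filter_cat /= add0n; case: ifP => _;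
   rewrite ?cats0 ?cats1.
Qed.

Lemma size_partial_table T : size (partial_table T) <= T.
Proof. by rewrite size_filter (leq_trans (count_size _ _)) ?size_iota. Qed.

(** Writing [T = k * N + i * B + j], the round compares [k] with digit [j] of the key code of point
    [i], and appends [T] on equality. *)
Lemma wp_insert h T (st : state F) :
  T < b * N -> num st 4 = 1 -> num st 6 = b -> num st 9 = B -> num st 10 = N ->
  regs st 12 = Num T -> regs st 3 = Hf h ->
  mem st = data_mem h ++ [seq Num T' | T' <- partial_table T] ->
  num st 13 = size (mem st) ->
  wp W insert st (B * 3 + 30)
    (fun st' => [/\ mem st' = data_mem h ++ [seq Num T' | T' <- partial_table T.+1],
       num st' 13 = size (mem st'), regs st' 12 = Num T.+1 &
       agree insert_scratch st st']).
Proof.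
move=> ltT s4 s6 s9 s10 s12 s3 mst s13.
have ltTW : T < W by lia.
have lt_r : T %% N < N by rewrite ltn_mod.
have lt_i : T %% N %/ B < n by rewrite ltn_divLR.
have lt_j : T %% N %% B < B by rewrite ltn_mod.
have sz : size (mem st) = n.+1 + size (partial_table T).
  by rewrite mst size_cat size_data_mem size_map.
have := size_partial_table T => le_sz.
rewrite addnC; apply: wp_seq_do; apply: (wp_arith (v := T %/ N)).
- by rewrite /= s12 s10.
- exact: leq_ltn_trans (leq_div _ _) ltTW.
apply: (wp_seq (t1 := 3) (t2 := 26 + B * 3)) => //.
apply: (wp_modulo (v := T %% N)) => //=; rewrite ?s12 ?s10 //.
apply: wp_seq_do; apply: (wp_arith (v := T %% N %/ B)).
- by rewrite /= s9.
- by lia.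
apply: (wp_seq (t1 := 3) (t2 := 22 + B * 3)) => //.
apply: (wp_modulo (v := T %% N %% B)) => //=; rewrite ?s9 //.
  by lia.
apply: wp_seq_do; apply: wp_do => /=.
rewrite mst nth_cat size_data_mem ltnS (ltnW lt_i) nth_data_mem //.
set x := nth p0 pts _.
apply: wp_seq_do; apply: wp_do => /=; rewrite s3 [key_code x %% W]modn_small ?key_codeW //.
apply: wp_seq_do; apply: wp_const; first by lia.
apply: (wp_seq (t1 := (B * 3).+1) (t2 := 18)); first by lia.
set st1 := set_reg _ 7 _.
(* The shift takes as many rounds as the key index, which is below [B]. *)
apply: (wp_weaken (t := (T %% N %% B * 3).+1)).
  by rewrite ltnS leq_mul2r ltnW ?orbT.
apply: (wp_impl _ (wp_div_loop (s := st1) s4 s6 erefl erefl erefl (key_codeW x) (ltn_trans lt_j BW))).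
move=> st2 [s2_19 mst2 ag2].
have agst2 : agree insert_scratch st st2.
  by apply: agree_trans ag2 => //; do !apply: agree_set => //.
have S2 := (agst2 4 isT, agst2 6 isT, agst2 9 isT, agst2 10 isT).
have [[S2_12 S2_13] S2_14] := (ag2 12 isT, ag2 13 isT, ag2 14 isT).
rewrite /st1 /= in s2_19 mst2 S2_12 S2_13 S2_14.
apply: (wp_seq (t1 := 3) (t2 := 15)) => //.
apply: (wp_modulo (v := slot_key (T %% N))) => //=.
- by rewrite s2_19 S2 s6 key_code_digit.
- by rewrite s2_19; exact: leq_ltn_trans (leq_div _ _) (key_codeW x).
apply: (wp_seq (t1 := 6) (t2 := 9)) => //.
set st3 := set_reg _ _ _.
have ag3 : agree insert_scratch st st3.
  by apply: agree_set.
have addT st4 : regs st4 12 = Num T -> num st4 4 = 1 ->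
    mem st4 = data_mem h ++ [seq Num T' | T' <- partial_table T.+1] ->
    num st4 13 = size (mem st4) ->
    agree insert_scratch st st4 ->
    wp W (Do (Arith Add 12 12 4)) st4 9 (fun st' =>
      [/\ mem st' = data_mem h ++ [seq Num T' | T' <- partial_table T.+1],
       num st' 13 = size (mem st'), regs st' 12 = Num T.+1 &
       agree insert_scratch st st']).
  move=> s12' s4' m4 s13' ag4.
  apply: (wp_arith (v := T.+1)); rewrite /= ?s12' ?s4' ?addn1 //; first by lia.
  by split=> //=; apply: agree_set.
(* Both strict comparisons lead here; assigning scratch register 7 serves as a no-op. *)
have skip : slot_key (T %% N) != T %/ N ->
    wp W (Do (Const 7 0)) st3 1 (fun st4 => wp W (Do (Arith Add 12 12 4)) st4 9 (fun st' =>
      [/\ mem st' = data_mem h ++ [seq Num T' | T' <- partial_table T.+1],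
       num st' 13 = size (mem st'), regs st' 12 = Num T.+1 &
       agree insert_scratch st st'])).
  move=> neq; apply: wp_const; first by lia.
  apply: addT => /=; rewrite ?S2_12 ?S2 ?mst2 ?S2_13 //.
  - by rewrite mst partial_tableS (negPf neq).
  - by apply: agree_set.
apply: wp_if => [|]; rewrite {1}/reg_lt /= S2_14 /= => cmp1.
  by apply: (wp_weaken (t := 1)) => //; apply: skip; lia.
apply: wp_if => [|]; rewrite {1}/reg_lt /= S2_14 /= => cmp2.
  by apply: (wp_weaken (t := 1)) => //; apply: skip; lia.
apply: wp_seq_do; apply: wp_do => /=; rewrite S2_12 S2_13 mst2.
have eqk : slot_key (T %% N) == T %/ N by lia.
(* Register 13 is the first address past the memory, so the write appends a cell. *)
have mem4 : set_nth (Num 0) (mem st) (num st 13) (regs st 12) =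
    data_mem h ++ [seq Num T' | T' <- partial_table T.+1].
  rewrite s13 set_nthE ltnn subnn /= cats1 mst partial_tableS eqk map_rcons.
  by rewrite -rcons_cat s12.
apply: (wp_arith (v := (size (mem st)).+1)); rewrite /= ?S2_13 ?S2 ?s13 ?s4 ?addn1 //.
  by lia.
apply: addT; rewrite /= ?S2_12 ?S2 //.
- by rewrite -{1}s13.
- by rewrite size_set_nth; apply/esym/maxn_idPl.
- by apply: agree_set.
Qed.

Lemma wp_preprocess h (st : state F) :
  num st 0 = n -> num st 2 = D -> mem st = data_mem h ->
  exists t, wp W preprocess st t (fun st' => mem st' = table_mem h).
Proof.
move=> s0 s2 mst; exists ((s * 3 + 6) + (b * N * (B * 3 + 30).+1).+1.+2.+4).
apply: wp_seq => //; apply: wp_impl (wp_powers (d := D) _ _ _ _ _ _) => //; try lia.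
move=> st1 [s1_4 s1_6 mst1 ag1].
have S1 := ag1 0 isT.
apply: wp_seq_do; apply: wp_do; rewrite /= S1 s0 mst1 mst nth_data_hash.
apply: wp_seq_do; apply: wp_const => //.
apply: wp_seq_do; apply: (wp_arith (v := N)); rewrite /= ?S1 ?s0 //; first by lia.
apply: wp_seq_do; apply: (wp_arith (v := b * N)); rewrite /= ?s1_6 //; first by lia.
apply: wp_seq_do; apply: wp_const; first by lia.
apply: wp_seq_do; apply: (wp_arith (v := n.+1)).
- by rewrite /= S1 s0 s1_4 addn1.
- by lia.
set st2 := set_reg _ 13 _.
(* Since [Write] copies a whole register, the invariant also records that register 12 really holds
   an integer. *)
pose I m st' := [/\ num st' 12 + m = b * N /\ regs st' 12 = Num (num st' 12),
  mem st' = data_mem h ++ [seq Num T' | T' <- partial_table (num st' 12)],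
  num st' 13 = size (mem st') & agree insert_scratch st2 st'].
have I0 : I (b * N) st2.
  by split; rewrite /= ?mst1 ?mst ?cats0 ?size_data_mem.
apply: wp_impl (wp_while _ I0) => [st3 [ge [m [[s3m _] mst3 _ ag3]]]|].
  rewrite mst3 /table_mem /slots /dict; congr (_ ++ [seq _ | T <- partial_table _]).
  by move: ge; rewrite /reg_lt (ag3 11 isT) /=; lia.
move=> m st3 [[s3m s3_12] mst3 s3_13 ag3].
have S3 := (ag3 3 isT, ag3 4 isT, ag3 6 isT, ag3 9 isT, ag3 10 isT, ag3 11 isT).
rewrite /reg_lt !S3 /= => lt12; exists m.-1; first by lia.
apply: wp_impl (wp_insert (h := h) lt12 _ _ _ _ s3_12 _ mst3 s3_13); rewrite ?S3 //.
move=> st4 [mst4 s4_13 s4_12 ag4]; split=> //.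
- by rewrite s4_12; split=> //=; lia.
- by rewrite s4_12.
- exact: agree_trans ag3 ag4.
Qed.

(** * Answering a query *)

(** If some point carries [k], an entry [k * N + r] with [r < N] occurs at or after [lo]. By
    sortedness entry [lo] lies between [k * N] and [k * N + r], so it carries [k] too, perhaps for
    another point. *)
Lemma slot_candidate k lo :
  0 < k -> has (fun p => k \in key_list p) pts ->
  (forall p, p < lo -> nth 0 slots p < k * N) ->
  (forall p, lo <= p < N -> k * N <= nth 0 slots p) ->
  k \in key_list (nth p0 pts (nth 0 slots lo %/ B %% n)).
Proof.
move=> k_gt0 /hasP[p p_pts kp] below above.
pose i := index p pts; pose j := index k (key_list p).
have lt_i : i < n by rewrite index_mem.
have lt_j : j < B by apply: leq_trans (size_key_list p); rewrite index_mem.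
pose r := i * B + j; have r_i : r %/ B = i by rewrite divnMDl // divn_small ?addn0.
have r_j : r %% B = j by rewrite modnMDl modn_small.
have lt_r : r < N by rewrite -ltn_divLR // r_i.
have T1_in : k * N + r \in slots.
  rewrite mem_slots modnMDl modn_small // divnMDl // divn_small // addn0.
  by rewrite /slot_key r_i r_j !nth_index.
pose e := index (k * N + r) slots.
have lt_e : e < size slots by rewrite index_mem.
have nth_e : nth 0 slots e = k * N + r by rewrite nth_index.
have le_lo : lo <= e by rewrite leqNgt; apply/negP => /below; rewrite nth_e; lia.
have lt_lo : lo < size slots by exact: leq_ltn_trans lt_e.
set T := nth 0 slots lo.
have geT : k * N <= T by apply: above; rewrite leqnn -size_slots.
have leT : T <= k * N + r.
  rewrite -nth_e; apply: (sorted_leq_nth leq_trans leqnn) => //.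
  exact: dict_sorted.
have divT : T %/ N = k.
  by apply/eqP; rewrite eqn_leq leq_divRL // geT andbT -ltnS ltn_divLR // mulSn; lia.
have : T \in slots by exact: mem_nth.
(* The index computed by the query, [T %/ B %% n], equals [T %% N %/ B], the point owning the slot
   of [T]. *)
rewrite mem_slots divT => /eqP; rewrite /slot_key modn_divl -/N => eqk.
(* As [k > 0], it is not the default 0 read past the end of a key list. *)
rewrite -eqk; apply: mem_nth; rewrite ltnNge; apply/negP => /(nth_default 0).
by rewrite eqk => k0; rewrite k0 in k_gt0.
Qed.

Definition found (q : point D) (v : value F) :=
  exists2 p, p \in pts & v = Pt p /\ s <= sim q p.

Definition hit k := has (fun p => k \in key_list p) pts.

Lemma wp_lookup h (q : point D) c l (st : state F) :
  c < B -> N < 2 ^ l ->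
  num st 1 = n -> num st 4 = 1 -> num st 6 = b -> num st 9 = B ->
  num st 10 = N -> num st 11 = n.+1 -> regs st 21 = Pt q -> num st 23 = s ->
  mem st = table_mem h ->
  num st 24 = c -> num st 19 = digits_val b (drop c (key_list q)) ->
  (has hit (take c (key_list q)) -> found q (regs st 0)) ->
  wp W lookup st (l * 8 + 30)
    (fun st' => [/\ mem st' = table_mem h, num st' 24 = c.+1,
       num st' 19 = digits_val b (drop c.+1 (key_list q)),
       has hit (take c.+1 (key_list q)) -> found q (regs st' 0)
     & agree lookup_scratch st st']).
Proof.
move=> ltcB ltNl s1 s4 s6 s9 s10 s11 s21 s23 mst s24 s19 found_c.
have lt_digits : all (fun k => k < b) (drop c (key_list q)).
  by apply/allP => k /mem_drop; exact: (allP (key_list_lt q)).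
(* Past the last key of [q] this is 0: the round still runs, but nothing is claimed of its
   candidate. *)
pose k := head 0 (drop c (key_list q)).
have lt_kb : k < b.
  by rewrite /k; case: (drop _ _) lt_digits => //= ? ? /andP[].
have kN_lt : k * N < b * N by rewrite ltn_pmul2r.
have digitsW : digits_val b (drop c (key_list q)) < W.
  apply: leq_trans codeW; apply: leq_trans (digits_val_lt lt_digits) _.
  by rewrite leq_pexp2l // size_drop (leq_trans (leq_subr _ _)) ?size_key_list.
rewrite addnC; apply: (wp_seq (t1 := 3) (t2 := 27 + l * 8)) => //.
apply: (wp_modulo (v := k)); rewrite ?s19 ?s6 ?digits_val_mod //.
apply: wp_seq_do.
apply: (wp_arith (v := digits_val b (drop c.+1 (key_list q)))).
- by rewrite /= s19 s6 -[b in _ %/ b]expn1 digits_val_drop // drop_drop add1n.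
- rewrite -[c.+1]add1n -drop_drop -(@digits_val_drop b _ 1) //.
  exact: leq_ltn_trans (leq_div _ _) digitsW.
apply: wp_seq_do; apply: (wp_arith (v := k * N)); rewrite /= ?s10 //; first by lia.
apply: wp_seq_do; apply: wp_const; first by lia.
apply: wp_seq_do; apply: wp_do => /=.
set st1 := set_reg _ 13 _.
have ag1 : agree lookup_scratch st st1 by do !apply: agree_set => //.
apply: (wp_seq (t1 := (l * 8).+1) (t2 := 22)); first by lia.
have table_nth p : p < size slots ->
    nth (Num 0) (mem st1) (n.+1 + p) = Num (nth 0 slots p).
  move=> ltp; rewrite [mem st1]mst /table_mem nth_cat size_data_mem.
  by rewrite ltnNge leq_addr /= addKn (nth_map 0).
have sz := size_slots.
apply: wp_impl (wp_search (a := slots) (o := n.+1) (x := k * N) (l := l) _ _ _ _ _ table_nth _ _ _ _ _);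
  rewrite ?size_slots //.
- move=> st2 [mst2 ag2 [le_lo below above]].
  have agst2 : agree lookup_scratch st st2 by exact: agree_trans ag1 ag2.
  have S2 := (agst2 1 isT, agst2 4 isT, agst2 6 isT, agst2 9 isT, agst2 10 isT,
              agst2 11 isT, agst2 21 isT, agst2 23 isT).
  set lo := num st2 12 in le_lo below above.
  have elt_lt : nth 0 slots lo < W.
    have [lt_lo|ge_lo] := ltnP lo (size slots); last by rewrite nth_default //; lia.
    suff : nth 0 slots lo < b * N by move: tableW; lia.
    by have := mem_nth 0 lt_lo; rewrite mem_filter mem_iota => /and3P[].
  apply: wp_seq_do; apply: (wp_arith (v := n.+1 + lo)).
  - by rewrite /= S2 s11.
  - by lia.
  apply: wp_seq_do; apply: wp_do => /=.
  (* When all entries are below [k * N], the read falls just past the memory and yields 0, matching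
     the default of [nth 0 slots]. *)
  have -> : nth (Num 0) (mem st2) (n.+1 + lo) = Num (nth 0 slots lo).
    rewrite mst2; have [lt_lo|ge_lo] := ltnP lo (size slots); first exact: table_nth.
    rewrite (nth_default 0 ge_lo) nth_default // [mem st1]mst.
    by rewrite size_cat size_data_mem size_map leq_add2l.
  set T := nth 0 slots lo in elt_lt *.
  apply: wp_seq_do; apply: (wp_arith (v := T %/ B)).
  - by rewrite /= S2 s9.
  - exact: leq_ltn_trans (leq_div _ _) elt_lt.
  have lt_i : T %/ B %% n < n by rewrite ltn_mod.
  apply: (wp_seq (t1 := 3) (t2 := 15)) => //.
  apply: (wp_modulo (v := T %/ B %% n)); rewrite /= ?S2 ?s1 //.
    exact: leq_ltn_trans (leq_div _ _) elt_lt.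
  apply: wp_seq_do; apply: wp_do => /=; rewrite mst2 mst nth_cat size_data_mem.
  rewrite ltnS (ltnW lt_i) nth_data_mem //.
  set p := nth p0 pts _.
  apply: wp_seq_do; apply: wp_do => /=; rewrite S2 s21.
  rewrite [sim q p %% W]modn_small; last first.
    by apply: leq_ltn_trans (sim_le q p) _; exact: ltnW.
  set st3 := set_reg _ 17 _.
  have ag3 : agree lookup_scratch st st3 by do !apply: agree_set => //.
  have reg0 : regs st2 0 = regs st 0 by rewrite (ag2 0 isT).
  have reg24 : num st3 24 = c by rewrite /= (ag2 24 isT) /= s24.
  have reg19 : num st3 19 = digits_val b (drop c.+1 (key_list q)).
    by rewrite /= (ag2 19 isT).
  have mst3 : mem st3 = table_mem h by rewrite /= mst2.
  have hit_p : hit k -> 0 < k -> k \in key_list q -> s <= sim q p.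
    move=> hit_k k_gt0 k_q; apply/common_key; exists k; first exact: mem_take k_q.
    by have /mem_take := slot_candidate k_gt0 hit_k below above.
  (* A hit among the first [c.+1] keys is an old one or the current key, and the latter makes the
     test on [p] succeed. *)
  have hits : has hit (take c.+1 (key_list q)) ->
      has hit (take c (key_list q)) || (s <= sim q p).
    have [lt_c|ge_c] := ltnP c (size (key_list q)); last first.
      by rewrite (take_oversize (leqW ge_c)) (take_oversize ge_c) => ->.
    rewrite (take_nth 0) // has_rcons => /orP[|->//] hit_c; apply/orP; right.
    have kE : nth 0 (key_list q) c = k by rewrite /k -nth0 nth_drop addn0.
    rewrite kE in hit_c; apply: hit_p; rewrite // -kE ?mem_nth //.
    exact: (keys_gt0 (mem_take (mem_nth _ lt_c))).
  apply: (wp_seq (t1 := 2) (t2 := 10)) => //.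
  have last_step st4 : num st4 24 = c -> num st4 4 = 1 ->
      mem st4 = table_mem h ->
      num st4 19 = digits_val b (drop c.+1 (key_list q)) ->
      (has hit (take c.+1 (key_list q)) -> found q (regs st4 0)) ->
      agree lookup_scratch st st4 ->
      wp W (Do (Arith Add 24 24 4)) st4 10
      (fun st' => [/\ mem st' = table_mem h, num st' 24 = c.+1,
         num st' 19 = digits_val b (drop c.+1 (key_list q)),
         has hit (take c.+1 (key_list q)) -> found q (regs st' 0)
       & agree lookup_scratch st st']).
    move=> r24 r4 m4 r19 f4 ag4.
    apply: (wp_arith (v := c.+1)); rewrite /= ?r24 ?r4 ?addn1 //; first by lia.
    by split=> //; apply: agree_set.
  apply: wp_if => [|]; rewrite {1}/reg_lt /= S2 s23 => cmp.
    apply: wp_const; first by lia.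
    apply: last_step => //=; rewrite ?S2 //; last exact: agree_set.
    by move/hits; rewrite leqNgt cmp orbF reg0.
  apply: wp_do; apply: last_step => //=; rewrite ?S2 //; last exact: agree_set.
  (* A successful test makes [p] a valid report, whether or not [k] was a hit. *)
  move=> _; exists p; last by split=> //; rewrite leqNgt.
  by rewrite mem_nth.
- exact: dict_sorted.
- by lia.
- by lia.
- by lia.
Qed.

Lemma wp_answer h (q : point D) l (st : state F) :
  N < 2 ^ l -> regs st 0 = Pt q -> num st 1 = n -> num st 3 = D ->
  mem st = table_mem h ->
  wp W answer st (s * 3 + 15 + B * (l * 8 + 31))
    (fun st' => mem st' = table_mem h /\
       (has hit (key_list q) -> found q (regs st' 0))).
Proof.
move=> ltNl s0 s1 s3 mst.
rewrite -addnA addnC; apply: (wp_seq (t1 := 1) (t2 := s * 3 + 14 + B * (l * 8 + 31))).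
  by lia.
apply: wp_do => /=.
apply: (wp_seq (t1 := s * 3 + 6) (t2 := (B * (l * 8 + 31)).+4.+4)).
  by lia.
apply: wp_impl (wp_powers (d := D) _ _ _ _ _ _) => //; try lia.
move=> st1 [s1_4 s1_6 mst1 ag1].
have S1 := (ag1 1 isT, ag1 21 isT); rewrite /= in S1 mst1.
apply: wp_seq_do; apply: wp_do; rewrite /= S1 s1 mst1 mst /table_mem nth_cat.
rewrite size_data_mem ltnSn nth_data_hash.
apply: wp_seq_do; apply: wp_const => //.
apply: wp_seq_do; apply: (wp_arith (v := N)); rewrite /= ?S1 ?s1 //; first by lia.
apply: wp_seq_do; apply: (wp_arith (v := n.+1)).
- by rewrite /= S1 s1 s1_4 addn1.
- by lia.
apply: wp_seq_do; apply: wp_do; rewrite /= S1 s0 modn_small ?key_codeW //.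
apply: wp_seq_do; apply: wp_const => //.
apply: wp_seq_do; apply: wp_const; first by lia.
set st2 := set_reg _ 24 _.
pose I m st' := [/\ num st' 24 + m = B, mem st' = table_mem h,
  num st' 19 = digits_val b (drop (num st' 24) (key_list q)),
  has hit (take (num st' 24) (key_list q)) -> found q (regs st' 0)
  & agree lookup_scratch st2 st'].
have I0 : I B st2 by split; rewrite /= ?mst1 ?mst ?drop0 ?take0.
have -> : l * 8 + 31 = (l * 8 + 30).+1 by rewrite addnS.
apply: wp_impl (wp_while _ I0) => [st3 [ge [m [s3m mst3 _ found3 ag3]]]|].
  split=> // hits; apply: found3.
  (* The loop made [B] rounds and the list has at most [B] keys, so all were tried. *)
  rewrite take_oversize //; apply: leq_trans (size_key_list q) _.
  by move: ge; rewrite /reg_lt (ag3 9 isT) /=; lia.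
move=> m st3 [s3m mst3 s3_19 found3 ag3].
have S3 := (ag3 1 isT, ag3 4 isT, ag3 6 isT, ag3 9 isT, ag3 10 isT,
            ag3 11 isT, ag3 21 isT, ag3 23 isT).
rewrite /reg_lt !S3 /= => lt24; exists m.-1; first by lia.
apply: wp_impl (wp_lookup (h := h) (q := q) lt24 ltNl _ _ _ _ _ _ _ _ mst3 erefl s3_19 found3);
  rewrite ?S3 /= ?S1 //.
move=> st4 [mst4 s4_24 s4_19 found4 ag4]; split=> //; rewrite ?s4_24 //.
- by lia.
- exact: agree_trans ag3 ag4.
Qed.

End Runs.

End DictionaryPrograms.

(** * Complexity and correctness *)

(** In the word exponent, [s * B] covers a packed key list and [s + B + 3] the addresses and table
    entries. *)
Definition dictionary_algorithm (R : realType) (s B : nat) : algorithm R :=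
  Algorithm (key_family s B R) (fun=> 1) (s * B + s + B + 4)
    (preprocess s B) (answer s B).

Lemma dictionary_word_bounds n D s B (W := (n + D).+2 ^ (s * B + s + B + 4)) :
  [/\ s < W, B < W, D.+1 < W & n.+1 + (D.+1 ^ s * (n * B) + n * B) < W].
Proof.
rewrite {}/W; set g := (n + D).+2; have g_ge2 : 1 < g by [].
have g_gt0 := ltnW g_ge2.
have ltX e e' : e < e' -> g ^ e < g ^ e' by move=> ?; rewrite ltn_exp2l.
have expand k : k <= g ^ k by exact/ltnW/ltn_expl.
have D_lt : D.+1 < g by rewrite /g; lia.
split.
- by apply: leq_ltn_trans (expand s) _; apply: ltX; lia.
- by apply: leq_ltn_trans (expand B) _; apply: ltX; lia.
- by apply: leq_trans D_lt _; rewrite -{1}[g]expn1 leq_pexp2l //; lia.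
have le_nB : n * B <= g ^ B.+1.
  by rewrite expnS leq_mul // /g; lia.
have le_b : D.+1 ^ s <= g ^ s by case: (s) => // s'; rewrite leq_exp2r // ltnW.
have le1 : D.+1 ^ s * (n * B) <= g ^ (s + B.+1) by rewrite expnD leq_mul.
have le2 : n * B <= g ^ (s + B.+1).
  by apply: leq_trans le_nB _; rewrite leq_pexp2l // leq_addl.
have le3 : n < g ^ (s + B.+1).
  apply: (@leq_ltn_trans (n + D).+1); first by lia.
  by rewrite -/g -{1}[g]expn1 leq_pexp2l // addnS.
(* Each of the three summands is at most [g ^ (s + B.+1)]; two more factors [g >= 2] leave room for
   four. *)
apply: (@leq_trans (g ^ (s + B.+1).+2)); last by rewrite leq_pexp2l //; lia.
rewrite !expnS; have := leq_mul g_ge2 g_ge2.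
have : 0 < g ^ (s + B.+1) by rewrite expn_gt0 g_gt0.
nia.
Qed.

(** The query program writes no memory cell, so one size serves both phases. *)
Lemma dictionary_runs (R : realType) (s B n D l : nat) (x : 'I_n -> point D)
    (w : draws (dictionary_algorithm R s B) n D) (pts := [seq x i | i <- enum 'I_n]) :
  0 < s -> 0 < B -> 0 < n -> n * B < 2 ^ l ->
  exists t0 s0, [/\ pre_run x w t0 s0, size (mem s0) = n.+1 + n * B &
    forall q : point D, exists t st, [/\ query_run x w q t st,
      t <= s * 3 + 15 + B * (l * 8 + 31), size (mem st) = n.+1 + n * B &
      has (hit s B pts) (key_list s B q) -> found pts q (regs st 0)]].
Proof.
move=> s_gt0 B_gt0 n_gt0 lt_nBl.
have size_pts : size pts = n by rewrite size_map size_enum_ord.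
have [sW BW DW tableW] := dictionary_word_bounds n D s B.
pose W := (n + D).+2 ^ (s * B + s + B + 4).
have codeW : (D.+1 ^ s) ^ B <= W.
  rewrite -expnM; apply: (@leq_trans ((n + D).+2 ^ (s * B))).
    by case: (s * B) => // e; rewrite leq_exp2r //; lia.
  by rewrite leq_pexp2l //; lia.
have small k : k <= n \/ k <= D -> k %% W = k.
  by move=> k_le; rewrite modn_small //; move: tableW DW; rewrite -/W; lia.
have mem0 : mem (pre_state x w) = data_mem pts (w ord0).
  have enum1 : enum 'I_1 = [:: ord0].
    by rewrite enum_ordSl (size0nil (size_enum_ord 0)).
  rewrite /data_mem -cats1 -map_comp.
  exact: (congr2 cat erefl (congr1 (map (fun j => Hf (w j))) enum1)).
have w_num0 : num (pre_state x w) 0 = size pts by rewrite /= small ?size_pts; [|left].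
have w_num2 : num (pre_state x w) 2 = D by rewrite /= small; [|right].
rewrite -/W -size_pts in n_gt0 tableW.
have [t [t0 [s0 [run0 _ mem_s0]]]] :=
  wp_preprocess s_gt0 B_gt0 n_gt0 sW BW DW codeW tableW w_num0 w_num2 mem0.
have size_s0 : size (mem s0) = n.+1 + n * B.
  rewrite mem_s0 size_cat size_data_mem size_map size_slots //.
  by rewrite size_pts.
exists t0, s0; split=> // q.
have := wp_answer s_gt0 B_gt0 n_gt0 sW BW DW codeW tableW (l := l) (h := w ord0)
  (st := query_state (A := dictionary_algorithm R s B) n (mem s0) q) (q := q).
case=> //; rewrite ?size_pts //=; try by rewrite small; auto.
move=> t1 [s1 [run1 le_t1 [mem_s1 found1]]]; exists t1, s1; split=> //.
  by exists t0, s0.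
by rewrite mem_s1 -mem_s0.
Qed.

Local Open Scope ring_scope.

(** By distributivity the total mass is a product of sums, each equal to 1. *)
Lemma prob_always (R : realType) (A : algorithm R) (n D : nat)
    (E : draws A n D -> Prop) : (forall w, E w) -> prob E = 1.
Proof.
move=> Ew; rewrite /prob (eq_bigl xpredT) => [|w]; last exact/asboolT.
rewrite -(bigA_distr_bigA (fun=> @hash_prob R D (alg_family A D))).
by rewrite big1 // => j _; exact: hash_prob_sum1.
Qed.

Lemma dictionary_solves (R : realType) (M s : nat) (S0 c delta : R) :
  (0 < M)%N -> (0 < s)%N -> (forall m : nat, (S0 <= m%:R) = (s <= m)%N) ->
  0 <= S0 -> c <= 1 -> 0 <= delta ->
  solves_near_neighbor (dictionary_algorithm R s (M ^ s)) M S0 c delta.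
Proof.
move=> M_gt0 s_gt0 sP S0_ge0 c_le1 delta_ge0 n D x q n_ge2 x_sparse q_sparse.
have B_gt0 : (0 < M ^ s)%N by rewrite expn_gt0 M_gt0.
have keysE (p : point D) : (nnz p <= M)%N -> key_list s (M ^ s) p = keys s p.
  move=> p_sparse; apply: take_oversize; apply: leq_trans (size_keys s p) _.
  by rewrite leq_exp2r.
suff always (w : draws (dictionary_algorithm R s (M ^ s)) n D) :
    (exists i, S0 <= (sim q (x i))%:R) ->
    exists t st i, [/\ query_run x w q t st, regs st 0%N = Pt (x i)
                      & c * S0 <= (sim q (x i))%:R].
  by rewrite prob_always ?gerBl.
case=> i; rewrite sP => /common_key[k kq kx].
have n_gt0 := ltnW n_ge2.
have [t0 [s0 [_ _ /(_ q)[t [st [run _ _ hits]]]]]] :=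
  (* Correctness ignores the step count, so the crude [l = n * B] suffices. *)
  dictionary_runs x w s_gt0 B_gt0 n_gt0 (ltn_expl _ (ltnSn 1)).
have [|p] := hits.
  apply/hasP; exists k; first by rewrite keysE.
  by apply/hasP; exists (x i); rewrite ?map_f ?mem_enum // keysE.
case/mapP => j _ -> [reg0 le_s]; exists t, st, j; split=> //.
by apply: (le_trans (y := S0)); rewrite ?sP // ler_piMl.
Qed.

Lemma dictionary_space (R : realType) (M s B : nat) (rho : R) :
  (0 < s)%N -> (0 < B)%N -> 0 <= rho ->
  space_bigO (dictionary_algorithm R s B) M (fun n => n%:R `^ (1 + rho)).
Proof.
move=> s_gt0 B_gt0 rho_ge0; exists (B.+2%:R) => n D x w n_ge2 x_sparse.
have n_gt0 := ltnW n_ge2.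
have size_le : (n.+1 + n * B)%:R <= B.+2%:R * n%:R `^ (1 + rho) :> R.
  apply: (@le_trans _ _ (B.+2%:R * n%:R)).
    by rewrite -natrM ler_nat; nia.
  rewrite ler_pM2l ?ltr0n // -{1}[n%:R]powRr1 ?ler0n //.
  by rewrite ler_powR ?ler1n // lerDl.
have [t0 [s0 [run0 size0 qrun]]] :=
  dictionary_runs x w s_gt0 B_gt0 n_gt0 (ltn_expl _ (ltnSn 1)).
split=> [|q _]; first by exists t0, s0; rewrite size0.
by have [t [st [run _ size1 _]]] := qrun q; exists t, st; rewrite size1.
Qed.

Lemma dictionary_query_time (R : realType) (M s B : nat) (rho : R) :
  (0 < s)%N -> (0 < B)%N -> 0 <= rho ->
  query_time_bigO (dictionary_algorithm R s B) M
    (fun n => n%:R `^ rho * ln n%:R).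
Proof.
move=> s_gt0 B_gt0 rho_ge0.
(* With [l = e + 1 + B] the step bound is [C + 8 * B * e], at most [(C + 8 * B) * e] because
   [n >= 2] gives [e >= 1]. Dividing by [ln 2] turns [e] into [ln n]. *)
pose C := (s * 3 + 15 + B * (B.+1 * 8 + 31))%N.
exists ((C + 8 * B)%:R / ln 2) => n D x w q n_ge2 x_sparse _.
have n_gt0 := ltnW n_ge2.
pose e := trunc_log 2 n.
have lt_nB : (n * B < 2 ^ (e.+1 + B))%N.
  by rewrite expnD; apply: ltn_mul; [exact: trunc_log_ltn | exact: ltn_expl].
have [t0 [s0 [_ _ /(_ q)[t [st [run le_t _ _]]]]]] :=
  dictionary_runs x w s_gt0 B_gt0 n_gt0 lt_nB.
exists t, st; split=> //.
have e_gt0 : (0 < e)%N by rewrite trunc_log_gt0.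
have ln2_gt0 : 0 < ln 2 :> R by rewrite ln_gt0 // ltr1n.
have e_le : e%:R * ln 2 <= ln n%:R :> R.
  rewrite mulr_natl -lnXn ?ltr0n // ler_ln ?posrE ?exprn_gt0 ?ltr0n //.
  by rewrite -natrX ler_nat trunc_logP.
have powR_ge1 : 1 <= n%:R `^ rho :> R by rewrite -[leLHS](powRr0 n%:R) ler_powR ?ler1n.
have ln_ge0 : 0 <= ln n%:R :> R by rewrite ln_ge0 // ler1n.
apply: (@le_trans _ _ ((C + 8 * B)%:R / ln 2 * ln n%:R)); last first.
  by rewrite ler_wpM2l ?ler_peMl // divr_ge0 ?ler0n // ltW.
rewrite mulrAC ler_pdivlMr //.
apply: (@le_trans _ _ ((C + 8 * B)%:R * (e%:R * ln 2))); last first.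
  by rewrite ler_wpM2l // ler0n.
rewrite mulrA ler_pM2r // -natrM ler_nat.
by apply: leq_trans le_t _; rewrite /C; nia.
Qed.

(** * Range of the exponent *)

Lemma rho_MH_ALSH_bounds (R : realType) (M : nat) (S0 c : R) :
  0 < S0 -> S0 <= M%:R -> 0 < c -> c < 1 ->
  0 <= rho_MH_ALSH M S0 c < 1.
Proof.
move=> S0_gt0 S0_le c_gt0 c_lt1; rewrite /rho_MH_ALSH.
set u := S0 / _; set v := c * S0 / _.
have cS0_gt0 : 0 < c * S0 by rewrite mulr_gt0.
have cS0_lt : c * S0 < S0 by rewrite gtr_pMl.
have u_den : 0 < 2 * M%:R - S0 by lra.
have v_den : 0 < 2 * M%:R - c * S0 by lra.
have u_gt0 : 0 < u by exact: divr_gt0.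
have v_gt0 : 0 < v by exact: divr_gt0.
have u_le1 : u <= 1 by rewrite ler_pdivrMr //; lra.
(* The map [t |-> t / (2 * M - t)] increases; after cross-multiplication the common term
   [c * S0 * S0] cancels. *)
have v_lt_u : v < u.
  rewrite ltr_pdivrMr // mulrAC ltr_pdivlMr //.
  rewrite !mulrBr [c * S0 * S0]mulrC [S0 * (2 * _)]mulrC [c * S0 * (2 * _)]mulrC.
  by rewrite ltrD2r ltr_pM2l //; lra.
have ln_v : ln v < 0 by rewrite ln_lt0 // v_gt0 (lt_le_trans v_lt_u).
have ln_vu : ln v < ln u by rewrite ltr_ln ?posrE.
(* From [ln v < ln u <= 0], dividing by [ln v < 0] reverses the inequalities. *)
rewrite ler_ndivlMr // mul0r ln_le0 //=.
by rewrite ltr_ndivrMr // mul1r.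
Qed.

Theorem corollary2 (R : realType) (M : nat) (S0 c : R) :
  (1 <= M)%N -> 0 < S0 -> S0 <= M%:R -> 0 < c -> c < 1 ->
  rho_MH_ALSH M S0 c < 1 /\
  forall delta : R, 0 < delta -> delta < 1 ->
    exists A : algorithm R,
      [/\ solves_near_neighbor A M S0 c delta,
          space_bigO A M (fun n => n%:R `^ (1 + rho_MH_ALSH M S0 c))
        & query_time_bigO A M
            (fun n => n%:R `^ (rho_MH_ALSH M S0 c) * ln n%:R)].
Proof.
move=> M_gt0 S0_gt0 S0_le c_gt0 c_lt1.
have /andP[rho_ge0 rho_lt1] := rho_MH_ALSH_bounds S0_gt0 S0_le c_gt0 c_lt1.
split=> // delta delta_gt0 _.
(* The threshold [s] is the ceiling of [S0]; inner products being integers, comparing them with [s]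
   or with [S0] is the same. *)
have ex_s : exists m : nat, S0 <= m%:R by exists M.
case: (ex_minnP ex_s) => s s_ge s_min.
have sP (m : nat) : (S0 <= m%:R) = (s <= m)%N.
  by apply/idP/idP => [/s_min//|]; rewrite -(ler_nat R); exact: le_trans.
have s_gt0 : (0 < s)%N by rewrite lt0n; apply: contraTneq s_ge => ->; rewrite -ltNge.
have B_gt0 : (0 < M ^ s)%N by rewrite expn_gt0 M_gt0.
exists (dictionary_algorithm R s (M ^ s)); split.
- by apply: dictionary_solves => //; exact: ltW.
- exact: dictionary_space.
- exact: dictionary_query_time.
Qed.
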